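(* Let $m,n,r,s$ be positive integers and suppose there exists a shiftable $SMR(m,n;r,s)$. Then for every integer $k\geq 1$: (1) there exists a shiftable $SMR(m,kn;kr,s)$; and (2) there exists a shiftable $SMR(km,kn;r,s)$.
   Context: A signed magic rectangle $SMR(m,n;r,s)$ is an $m\times n$ array, some of whose cells are filled with integers and the others empty, such that exactly $r$ cells in every row and exactly $s$ cells in every column are filled (so $mr=ns$), every element of a set $X$ appears exactly once in the array, and the sum of the entries of each row and of each column is zero. Here $X=\{\pm1,\pm2,\ldots,\pm mr/2\}$ if $mr$ is even, and $X=\{0,\pm1,\ldots,\pm (mr-1)/2\}$ if $mr$ is odd. An array is shiftable if every row and every column contains the same number of positive entries as negative entries.
   Formalization: The case m = n = 1 with k ≥ 2 is excluded: the 1×1 array (0) is a shiftable SMR(1,1;1,1), but neither SMR(1,k;k,1) nor SMR(k,k;1,1) exists for k ≥ 2, since every column would have a single filled cell equal to 0. *)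

(* Defs.v *)
From mathcomp Require Import all_boot all_order all_algebra.

Set Implicit Arguments.
Unset Strict Implicit.
Unset Printing Implicit Defensive.

Import Order.TTheory GRing.Theory Num.Theory.

(* A partially filled array: [None] is an empty cell, [Some x] a cell filled
   with x. *)
Definition parray (m n : nat) := 'M[option int]_(m, n).

(* The symbol set with N elements: {+-1, ..., +-N/2} for N even and
   {0, +-1, ..., +-(N-1)/2} for N odd. *)
Definition symbols (N : nat) : pred int := fun x =>
  if odd N then (`|x| <= N.-1./2)%N else (1 <= `|x| <= N./2)%N.

(* Entries outside [symbols (m * r)] need not be excluded explicitly: there are
   m * r filled cells, and as many symbols. *)
Definition is_SMR (m n r s : nat) (A : parray m n) : Prop :=
  [/\ forall i : 'I_m, #|[set j : 'I_n | A i j != None]| = r,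
      forall j : 'I_n, #|[set i : 'I_m | A i j != None]| = s,
      forall x : int, symbols (m * r) x ->
        exists! c : 'I_m * 'I_n, A c.1 c.2 = Some x,
      forall i : 'I_m, (\sum_(j < n) odflt 0 (A i j) = 0)%R
    & forall j : 'I_n, (\sum_(i < m) odflt 0 (A i j) = 0)%R].

Definition pos_cell (c : option int) : bool := oapp (fun x => 0 < x)%R false c.
Definition neg_cell (c : option int) : bool := oapp (fun x => x < 0)%R false c.

Definition shiftable (m n : nat) (A : parray m n) : Prop :=
  (forall i : 'I_m, #|[set j : 'I_n | pos_cell (A i j)]| =
                    #|[set j : 'I_n | neg_cell (A i j)]|) /\
  (forall j : 'I_n, #|[set i : 'I_m | pos_cell (A i j)]| =
                    #|[set i : 'I_m | neg_cell (A i j)]|).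

Definition exists_shiftable_SMR (m n r s : nat) : Prop :=
  exists A : parray m n, is_SMR r s A /\ shiftable A.

(* Main.v *)
(* Replace each nonzero entry x of the array by x + sgn(x) t N, where N = mr/2
   and t < k. Each line has as many positive as negative entries, so its sum
   remains 0, and the absolute values now run through ]tN, (t+1)N]. Hence the k
   shifted copies placed side by side, or along the diagonal, use every symbol
   once. This needs mr to be even. If mr is odd then so are r and s, so every
   row and every column contains a zero; as zero occurs only once, the array is
   1 x 1. *)
Require Import Defs.
From mathcomp Require Import all_boot all_order all_algebra zify.

Set Implicit Arguments.
Unset Strict Implicit.
Unset Printing Implicit Defensive.

Import Order.TTheory GRing.Theory Num.Theory.

(** * Shifts and balanced lines *)

Definition entry (c : option int) : int := odflt 0%R c.

Definition shift (d : nat) (x : int) : int := (x + sgz x * d%:Z)%R.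

(* The last sum is the number of positive entries minus that of negative ones. *)
Definition balanced (T : finType) (r : nat) (l : T -> option int) : Prop :=
  [/\ \sum_j (l j != None) = r, (\sum_j entry (l j) = 0)%R
    & (\sum_j sgz (entry (l j)) = 0)%R].

(** Rows and columns are indexed by arbitrary finite types, so that [k] copies can be indexed by
    pairs in ['I_k * C] without index arithmetic. *)
Definition shiftable_array (R C : finType) (r s N : nat)
    (A : R -> C -> option int) : Prop :=
  [/\ forall i, balanced r (A i), forall j, balanced s (A^~ j)
    & forall x, symbols N x -> exists! c : R * C, A c.1 c.2 = Some x].

Lemma sgz_shift d x : sgz (shift d x) = sgz x.
Proof. rewrite /shift; case: (sgzP x) => hx; case: sgzP; lia. Qed.

Lemma entry_shift d c :
  entry (omap (shift d) c) = (entry c + sgz (entry c) * d%:Z)%R.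
Proof. by case: c. Qed.

Lemma balanced_cards (T : finType) r (l : T -> option int) :
  balanced r l <->
  [/\ #|[set j | l j != None]| = r, (\sum_j odflt 0 (l j) = 0)%R
    & #|[set j | pos_cell (l j)]| = #|[set j | neg_cell (l j)]|].
Proof.
have cardE (P : pred T) : #|[set j | P j]| = \sum_j P j.
  by rewrite cardsE -sum1_card big_mkcond.
have sgzE c : sgz (entry c) = ((pos_cell c : nat)%:Z - (neg_cell c : nat)%:Z)%R.
  by case: c => [x|] //=; rewrite /pos_cell /neg_cell /=; case: sgzP; lia.
rewrite /balanced !cardE (eq_bigr _ (fun j _ => sgzE (l j))) big_split /=.
rewrite sumrN -!(big_morph _ PoszD (erefl : Posz 0 = 0%R)).
by split=> -[h1 h2 h3]; split=> //; lia.
Qed.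

Lemma balanced_bij (T U : finType) (f : T -> U) r (l : U -> option int) :
  bijective f -> balanced r l -> balanced r (l \o f).
Proof.
move=> bf [h1 h2 h3]; have bf' := onW_bij predT bf.
by split; [move: h1 | move: h2 | move: h3]; rewrite (reindex f bf').
Qed.

Lemma balanced_shift (T : finType) d r (l : T -> option int) :
  balanced r l -> balanced r (fun j => omap (shift d) (l j)).
Proof.
case=> h1 h2 h3; split.
- by rewrite -h1; apply: eq_bigr => j _; case: (l j).
- rewrite (eq_bigr _ (fun j _ => entry_shift d (l j))) big_split /= h2.
  by rewrite -mulr_suml h3 mul0r.
- apply: etrans h3; apply: eq_bigr => j _.
  by rewrite entry_shift; apply: sgz_shift.
Qed.

Lemma balanced_concat (T : finType) k r (l : 'I_k -> T -> option int) :
  (forall t, balanced r (l t)) ->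
  balanced (k * r) (fun p : 'I_k * T => l p.1 p.2).
Proof.
move=> h; split.
- rewrite -(pair_bigA _ (fun t j => (l t j != None) : nat)) /=.
  rewrite (eq_bigr (fun=> r)) => [|t _]; last by case: (h t).
  by rewrite sum_nat_const card_ord.
- rewrite -(pair_bigA _ (fun t j => entry (l t j))) /=.
  by apply: big1 => t _; case: (h t).
- rewrite -(pair_bigA _ (fun t j => sgz (entry (l t j)))) /=.
  by apply: big1 => t _; case: (h t).
Qed.

(** Serves both rows and columns of the diagonal arrangement: outside block [u] all cells are empty
    and add nothing to the three sums. *)
Lemma balanced_extend (T : finType) k (u : 'I_k) r (l : T -> option int) :
  balanced r l ->
  balanced r (fun p : 'I_k * T => if u == p.1 then l p.2 else None).
Proof.
case=> h1 h2 h3; split.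
- rewrite -(pair_bigA _ (fun t j => ((if u == t then l j else None) != None) : nat)).
  rewrite (bigD1 u) //= eqxx h1 big1 ?addn0 // => t; rewrite eq_sym => /negPf tu.
  by apply: big1 => j _; rewrite tu.
- rewrite -(pair_bigA _ (fun t j => entry (if u == t then l j else None))).
  rewrite (bigD1 u) //= eqxx h2 big1 ?addr0 // => t; rewrite eq_sym => /negPf tu.
  by apply: big1 => j _; rewrite tu.
- rewrite -(pair_bigA _ (fun t j => sgz (entry (if u == t then l j else None)))).
  rewrite (bigD1 u) //= eqxx h3 big1 ?addr0 // => t; rewrite eq_sym => /negPf tu.
  by apply: big1 => j _; rewrite tu.
Qed.

(** Without a zero, the filled cells split into equally many positive and negative ones, so [r]
    would be even. *)
Lemma balanced_odd_zero (T : finType) r (l : T -> option int) :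
  balanced r l -> odd r -> exists j, l j = Some 0%R.
Proof.
move=> /balanced_cards [h1 _ h3] or.
case: (pickP (fun j => l j == Some 0%R)) => [j /eqP|nz]; first by exists j.
have E : [set j | l j != None] = [set j | pos_cell (l j)] :|: [set j | neg_cell (l j)].
  apply/setP=> j; rewrite !inE; have := nz j.
  case: (l j) => [x|] // /negbT; rewrite (inj_eq Some_inj) /pos_cell /neg_cell /=.
  by case: ltgtP.
have := cardsUI [set j | pos_cell (l j)] [set j | neg_cell (l j)].
rewrite -E h1 h3 (_ : _ :&: _ = set0) ?cards0; last first.
  apply/setP=> j; rewrite !inE; case: (l j) => [x|] //=.
  by rewrite /pos_cell /neg_cell /=; case: ltgtP.
lia.
Qed.

(** * Passage between matrices and arrays over finite types *)

Lemma exists_shiftable_array m n r s : exists_shiftable_SMR m n r s ->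
  exists A : 'I_m -> 'I_n -> option int, shiftable_array r s (#|'I_m| * r) A.
Proof.
case=> A [[h1 h2 h3 h4 h5] [h6 h7]]; exists (fun i j => A i j).
by rewrite card_ord; split=> // i; apply/balanced_cards; split.
Qed.

(** Enumerating [R] and [C] only relabels the lines, which affects neither balance nor the
    occurrences of symbols. *)
Lemma shiftable_arrayP (R C : finType) r s m n (A : R -> C -> option int) :
  #|R| = m -> #|C| = n -> shiftable_array r s (m * r) A ->
  exists_shiftable_SMR m n r s.
Proof.
move=> <- <- [hR hC hx].
have bR := @enum_val_bij R; have bC := @enum_val_bij C.
pose B : parray #|R| #|C| := (\matrix_(i, j) A (enum_val i) (enum_val j))%R.
have rowB i : balanced r (B i).
  have [h1 h2 h3] := balanced_bij bC (hR (enum_val i)).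
  by split; [apply: etrans h1 | apply: etrans h2 | apply: etrans h3];
     apply: eq_bigr => j _; rewrite mxE.
have colB j : balanced s (B^~ j).
  have [h1 h2 h3] := balanced_bij bR (hC (enum_val j)).
  by split; [apply: etrans h1 | apply: etrans h2 | apply: etrans h3];
     apply: eq_bigr => i _; rewrite mxE.
exists B; split; split.
- by move=> i; have /balanced_cards[] := rowB i.
- by move=> j; have /balanced_cards[] := colB j.
- move=> x /hx [[i j] /= [hij uij]]; exists (enum_rank i, enum_rank j).
  split=> [|[i' j']] /=; rewrite mxE ?enum_rankK // => hB.
  by case: (uij (_, _) hB) => -> ->; rewrite !enum_valK.
- by move=> i; have /balanced_cards[] := rowB i.
- by move=> j; have /balanced_cards[] := colB j.
- by move=> i; have /balanced_cards[] := rowB i.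
- by move=> j; have /balanced_cards[] := colB j.
Qed.

(** * Counting filled cells; the odd case *)

Section ShiftableArray.

Variables (R C : finType) (r s : nat) (A : R -> C -> option int).
Hypothesis hA : shiftable_array r s (#|R| * r) A.

Lemma card_filled : #|[set c : R * C | A c.1 c.2 != None]| = #|R| * r.
Proof.
rewrite cardsE -sum1_card big_mkcond /=.
rewrite -(pair_bigA _ (fun i j => if A i j != None then 1 else 0)) /=.
rewrite (eq_bigr (fun=> r)) ?sum_nat_const // => i _.
case: hA => /(_ i) [<- _ _] _ _.
by apply: eq_bigr => j _; case: (A i j).
Qed.

Lemma size_balance : #|R| * r = #|C| * s.
Proof.
rewrite -card_filled cardsE -sum1_card big_mkcond /=.
rewrite -(pair_bigA _ (fun i j => if A i j != None then 1 else 0)) /=.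
rewrite exchange_big (eq_bigr (fun=> s)) ?sum_nat_const // => j _.
case: hA => _ /(_ j) [<- _ _] _.
by apply: eq_bigr => i _; case: (A i j).
Qed.

Lemma odd_shiftable_array : odd (#|R| * r) -> #|R| = 1 /\ #|C| = 1.
Proof.
move=> o; case: (hA) => hR hC hx.
have /hx [[i0 j0] /= [_ u0]] : symbols (#|R| * r) 0%R by rewrite /symbols o.
have or : odd r by move: o; rewrite oddM => /andP[].
(* Counting the filled cells by columns gives the same odd number. *)
have os : odd s by move: o; rewrite size_balance oddM => /andP[].
split; [apply: (eq_card1 (x := i0)) | apply: (eq_card1 (x := j0))] => z;
  rewrite !inE.
- have [j hj] := balanced_odd_zero (hR z) or.
  by case: (u0 (z, j) hj) => ->; rewrite eqxx.
- have [i hi] := balanced_odd_zero (hC z) os.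
  by case: (u0 (i, z) hi) => _ ->; rewrite eqxx.
Qed.

(** * Symbols and their shifts in the even case *)

Hypothesis evenN : ~~ odd (#|R| * r).
Let N := (#|R| * r)./2.

(* The symbols are as many as the filled cells, so no other entry is left. *)
Lemma entry_bounds i j x : A i j = Some x -> 1 <= `|x| <= N.
Proof.
move=> hx; case: (hA) => _ _ hsym.
(* [val] lists the symbols: the boolean is the sign, and since [Negz t] is -(t+1), both branches
   have absolute value t+1. *)
pose val (p : bool * 'I_N) : int := if p.1 then Posz p.2.+1 else Negz p.2.
have hval p : symbols (#|R| * r) (val p).
  rewrite /symbols (negPf evenN) /val -/N.
  by case: p => [[] [t ht]] /=; lia.
have hval' p : exists c, A c.1 c.2 == Some (val p).
  by have [c [/eqP hc _]] := hsym _ (hval p); exists c.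
pose f p := xchoose (hval' p).
have fP p : A (f p).1 (f p).2 = Some (val p) by apply/eqP/(xchooseP (hval' p)).
have finj : injective f.
  move=> p q epq; have := fP p; rewrite epq fP => -[].
  by case: p q {epq} => [[] p] [[] q] //=; rewrite /val /= => -[] /ord_inj ->.
have sub : [set f p | p : bool * 'I_N] \subset [set c | A c.1 c.2 != None].
  by apply/subsetP=> _ /imsetP[p _ ->]; rewrite inE fP.
(* The injective [f] reaches 2N cells, which is the number of filled cells, so every filled cell
   holds some [val p]. *)
have /setP/(_ (i, j)) : [set f p | p : bool * 'I_N] = [set c | A c.1 c.2 != None].
  apply/eqP; rewrite eqEcard sub /= card_filled card_imset // card_prod.
  by rewrite card_bool card_ord /N; lia.
rewrite !inE /= hx /= => /imsetP[p _ ep].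
move: (fP p); rewrite -ep /= hx => -[->].
by have := hval p; rewrite /symbols (negPf evenN).
Qed.

(** Shifting keeps the sign, and the absolute value less one becomes tN + (|x| - 1) with |x| - 1 <
    N, so division by N recovers [t]. *)
Lemma shift_inj t t' x x' : 1 <= `|x| <= N -> 1 <= `|x'| <= N ->
  shift (t * N) x = shift (t' * N) x' -> t = t' /\ x = x'.
Proof.
move=> hx hx' e.
have es : sgz x = sgz x' by rewrite -(sgz_shift (t * N)) e sgz_shift.
have absE (u : nat) (y : int) : 1 <= `|y| -> `|shift (u * N) y| = u * N + `|y|.-1 + 1.
  by rewrite /shift; case: sgzP; lia.
have N0 : 0 < N by lia.
have ea : t * N + `|x|.-1 = t' * N + `|x'|.-1.
  by have := absE t x; have := absE t' x'; rewrite e; lia.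
have et : t = t'.
  have := congr1 (divn^~ N) ea.
  by rewrite !divnMDl // !divn_small ?addn0 //; lia.
split=> //; move: e; rewrite /shift es et; exact: addIr.
Qed.

Lemma shift_surj k (x : int) : 1 <= `|x| <= k * N ->
  exists (t : 'I_k) y, [/\ 1 <= `|y| <= N & shift (t * N) y = x].
Proof.
move=> hx; have N0 : 0 < N by nia.
(* The block ]tN, (t+1)N] containing |x| is found by dividing |x| - 1, not |x|, by N; the remainder
   is |y| - 1. *)
have ht : `|x|.-1 %/ N < k by rewrite ltn_divLR //; lia.
have hd := divn_eq `|x|.-1 N; have hm := ltn_pmod `|x|.-1 N0.
exists (Ordinal ht) => /=; move: (`|x|.-1 %/ N) (`|x|.-1 %% N) hd hm => q z hd hm.
exists (sgz x * z.+1%:Z)%R; rewrite /shift; split.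
  by case: sgzP; lia.
by rewrite sgzM sgz_id mulr1 -mulrDr; case: sgzP; lia.
Qed.

(* Transfers the symbol condition to any arrangement of k shifted copies:
   cell (t, c) is where copy t puts the cell c of A. *)
Lemma shifted_copies k (R' C' : finType) M (B : R' -> C' -> option int)
    (cell : 'I_k -> R * C -> R' * C') :
  M = k * (#|R| * r) ->
  (forall t c, B (cell t c).1 (cell t c).2 = omap (shift (t * N)) (A c.1 c.2)) ->
  (forall c' x, B c'.1 c'.2 = Some x -> exists t c, c' = cell t c) ->
  forall x, symbols M x -> exists! c', B c'.1 c'.2 = Some x.
Proof.
move=> -> hB hcell x; case: (hA) => _ _ hsym.
have halfE : (k * (#|R| * r))./2 = k * N.
  by rewrite -(even_halfK evenN) -doubleMr doubleK.
rewrite /symbols oddM (negPf evenN) andbF halfE => /shift_surj [t [y [hy <-]]].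
have [|c [hc uc]] := hsym y; first by rewrite /symbols (negPf evenN).
exists (cell t c); split=> [|c' hc']; first by rewrite hB hc.
(* Any other occurrence of the symbol lies in some copy; [shift_inj] identifies the copy and the
   original entry, whose cell in [A] is unique. *)
have [t' [d ed]] := hcell _ _ hc'; move: hc'; rewrite ed hB.
case hd: (A _ _) => [z|] //= [] e.
have [et ez] := shift_inj (entry_bounds hd) hy e.
by rewrite (uc d) ?hd ?ez // (ord_inj et).
Qed.

(** * The two arrangements *)

Definition row_copies k (i : R) (p : 'I_k * C) : option int :=
  omap (shift (p.1 * N)) (A i p.2).

Definition diagonal_copies k (q : 'I_k * R) (p : 'I_k * C) : option int :=
  if q.1 == p.1 then omap (shift (q.1 * N)) (A q.2 p.2) else None.

Lemma shiftable_row_copies k :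
  shiftable_array (k * r) s (#|R| * (k * r)) (@row_copies k).
Proof.
case: (hA) => hR hC _; split.
- move=> i.
  apply: (balanced_concat (l := fun t j => omap (shift (t * N)) (A i j))) => t.
  exact: balanced_shift.
(* A column meets a single copy, so it is one shifted column of [A]. *)
- by move=> [t j]; apply: balanced_shift.
- apply: (shifted_copies (B := @row_copies k) (cell := fun t c => (c.1, (t, c.2)))).
  + by rewrite mulnCA.
  + by [].
  + by move=> [i [t j]] x _; exists t, (i, j).
Qed.

Lemma shiftable_diagonal_copies k :
  shiftable_array r s (k * #|R| * r) (@diagonal_copies k).
Proof.
case: (hA) => hR hC _; split.
- move=> [u i] /=.
  apply: (balanced_extend u (l := fun j => omap (shift (u * N)) (A i j))).
  exact: balanced_shift.
- move=> [t j] /=.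
  have [] := balanced_extend t (balanced_shift (t * N) (hC j)).
  (* The shift is read off the row block; in column block [t] only row block [t] is filled, so the
     shift is constant along the column. *)
  have E (p : 'I_k * R) : diagonal_copies p (t, j)
      = if t == p.1 then omap (shift (t * N)) (A p.2 j) else None.
    by rewrite /diagonal_copies /= eq_sym; case: eqP => // ->.
  by move=> h1 h2 h3; split; [apply: etrans h1 | apply: etrans h2 | apply: etrans h3];
    apply: eq_bigr => p _; rewrite E.
- apply: (shifted_copies (B := @diagonal_copies k) (cell := fun t c => ((t, c.1), (t, c.2)))).
  + by rewrite mulnA.
  + by move=> t c; rewrite /diagonal_copies eqxx.
  + by move=> [[u i] [t j]] x; rewrite /diagonal_copies /=; case: eqP => // -> _; exists t, (i, j).
Qed.

End ShiftableArray.

Theorem theorem5 (m n r s : nat)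
    (hm : 0 < m) (hn : 0 < n) (hr : 0 < r) (hs : 0 < s)
    (hA : exists_shiftable_SMR m n r s)
    (k : nat) (hk : 1 <= k)
    (* the 1 x 1 array (0) is a shiftable SMR(1,1;1,1), but its zero cannot be
       shifted and both conclusions fail for it as soon as k >= 2 *)
    (hdeg : (m, n) = (1, 1) -> k = 1) :
  exists_shiftable_SMR m (k * n) (k * r) s /\
  exists_shiftable_SMR (k * m) (k * n) r s.
Proof.
(* For k = 1 the given array serves, whatever the parity of mr; for other k, [hdeg] excludes the 1 x
   1 array and hence odd mr. *)
have [k1|k1] := eqVneq k 1; first by rewrite k1 !mul1n.
have [A sA] := exists_shiftable_array hA.
have evenN : ~~ odd (#|'I_m| * r).
  apply/negP=> /(odd_shiftable_array sA); rewrite !card_ord => -[m1 n1].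
  by move/eqP: k1; apply; apply: hdeg; rewrite m1 n1.
split.
- have := shiftable_row_copies sA evenN k; rewrite {1}card_ord.
  by apply: shiftable_arrayP; rewrite ?card_prod !card_ord.
- have := shiftable_diagonal_copies sA evenN k; rewrite {1}card_ord.
  by apply: shiftable_arrayP; rewrite card_prod !card_ord.
Qed.
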